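(* Let $\alpha = (\alpha_1,\dots,\alpha_n)$ be a graphic degree sequence. Then the graph $G = (\mathcal{P}(\alpha), \mathcal{F}(\alpha))$, with vertex set $\mathcal{P}(\alpha)$ and edge set $\mathcal{F}(\alpha)$, is a threshold graph.
   Context: All graphs are simple and undirected. A degree sequence of length $n$ is an integer sequence $\alpha=(\alpha_1,\dots,\alpha_n)$ with $n-1 \ge \alpha_1 \ge \cdots \ge \alpha_n \ge 0$. A (labeled) realization of $\alpha$ is a simple graph on the labeled vertex set $\{v_1,\dots,v_n\}$ in which $v_i$ has degree $\alpha_i$ for every $i$; $\alpha$ is graphic if it has at least one realization. The forced set $\mathcal{F}(\alpha)$ is the set of all edges $v_iv_j$ (between labeled vertices, $i \ne j$) that appear in every realization of $\alpha$, and $\mathcal{P}(\alpha) = \{ v_i \mid \exists v_j : v_iv_j \in \mathcal{F}(\alpha)\}$ is the set of vertices lying on some forced edge. A threshold graph is a graph whose degree sequence has precisely one labeled realization (i.e. it is the only simple graph on its vertex set in which each vertex has the given degree); equivalently, a graph with no induced subgraph on four vertices isomorphic to $2K_2$, $P_4$ (the path on 4 vertices) or $C_4$. *)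

(* Defs.v *)
From mathcomp Require Import all_boot.

Set Implicit Arguments.
Unset Strict Implicit.
Unset Printing Implicit Defensive.

(* A simple graph is a pair (V, E) with V : {set T} and E : {set {set T}}; the
   edge vw is the 2-element set [set v; w], so two graphs on the same labeled
   vertex set are equal exactly when their edge sets are equal. *)
Definition is_graph (T : finType) (V : {set T}) (E : {set {set T}}) : bool :=
  [forall e in E, (#|e| == 2) && (e \subset V)].

Definition degree (T : finType) (E : {set {set T}}) (v : T) : nat :=
  #|[set e in E | v \in e]|.

Definition realizes (T : finType) (V : {set T}) (d : T -> nat)
    (E : {set {set T}}) : bool :=
  is_graph V E && [forall v in V, degree E v == d v].

Definition threshold (T : finType) (V : {set T}) (E : {set {set T}}) : bool :=
  is_graph V E && (#|[set E' | realizes V (degree E) E']| == 1).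

Definition degree_sequence (n : nat) (alpha : n.-tuple nat) : bool :=
  all (fun d => d <= n.-1) alpha && sorted geq alpha.

(* Vertices are indexed from 0: the element i of 'I_n stands for v_(i+1). *)
Definition realization (n : nat) (alpha : n.-tuple nat)
    (E : {set {set 'I_n}}) : bool :=
  realizes [set: 'I_n] (tnth alpha) E.

Definition graphic (n : nat) (alpha : n.-tuple nat) : Prop :=
  exists E : {set {set 'I_n}}, realization alpha E.

Definition forced_set (n : nat) (alpha : n.-tuple nat) : {set {set 'I_n}} :=
  [set e : {set 'I_n} | (#|e| == 2) &&
    [forall E : {set {set 'I_n}}, realization alpha E ==> (e \in E)]].

(* The case j = i contributes nothing, since [set i; i] has one element. *)
Definition forced_vertices (n : nat) (alpha : n.-tuple nat) : {set 'I_n} :=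
  [set i | [exists j, [set i; j] \in forced_set alpha]].

(* Main.v *)
Require Import Defs.
From mathcomp Require Import all_boot.

(** If [ij] is forced, [k] differs from [i] and the degree of [k] is at least
    that of [j], then [ik] is forced: in a realization without [ik], degree
    comparison gives a vertex [l] adjacent to [k] but not to [j], and exchanging
    [ij], [kl] for [ik], [jl] gives a realization without [ij]. So in the graph
    of forced edges the neighborhoods are nested along the degrees of [alpha].
    Such a graph is the only realization of its degrees: if another one existed,
    take a vertex [v] of largest [alpha]-degree on the symmetric difference,
    an edge [vw] that is only in the other graph, and an edge [wx] that is only
    in the forced graph; nestedness then makes [vw] forced. *)

Section Graphs.

Variable T : finType.
Implicit Types (V e : {set T}) (E F A B : {set {set T}}) (v w : T).

Lemma is_graphP V E e : is_graph V E -> e \in E -> #|e| = 2 /\ e \subset V.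
Proof. by move=> /forall_inP gE /gE /andP[/eqP]. Qed.

Lemma edge_neq V E v w : is_graph V E -> [set v; w] \in E -> v != w.
Proof. by move=> gE /(is_graphP _ _ _ gE)[]; rewrite cards2; case: (v != w). Qed.

Definition neighbors E v : {set T} := [set w | [set v; w] \in E].

(** The map sending [w] to [[set v; w]] is a bijection from neighbors to incident edges; injectivity
    rests on the absence of loops. *)
Lemma degree_neighbors V E v : is_graph V E -> degree E v = #|neighbors E v|.
Proof.
move=> gE; rewrite /degree.
have -> : [set e in E | v \in e] = (fun w => [set v; w]) @: neighbors E v.
  apply/setP=> e; rewrite inE; apply/andP/imsetP => [[eE ve]|[w]].
    have [/eqP/cards2P[a [b [_ eab]]] _] := is_graphP _ _ _ gE eE.
    move: ve eE; rewrite eab !inE => /orP[]/eqP-> eE; first by exists b; rewrite ?inE.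
    by exists a; rewrite ?inE setUC.
  by rewrite inE => vwE ->; rewrite vwE !inE eqxx.
apply: card_in_imset => x y; rewrite !inE => vx vy eqxy.
have: x \in [set v; y] by rewrite -eqxy !inE eqxx orbT.
by rewrite !inE eq_sym (negPf (edge_neq _ _ _ _ gE vx)) => /eqP.
Qed.

(** In this form the degree is additive over disjoint unions of edge sets. *)
Lemma degree_sum E v : degree E v = \sum_(e in E) (v \in e).
Proof.
rewrite /degree -sum1_card [RHS]big_mkcond [LHS]big_mkcond /=.
by apply: eq_bigr => e _; rewrite inE; case: (e \in E); case: (v \in e).
Qed.

Lemma set2_neq (a b c d : T) : a != c -> a != d -> [set a; b] != [set c; d].
Proof.
move=> ac ad; apply/eqP => /setP/(_ a).
by rewrite !inE eqxx (negPf ac) (negPf ad).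
Qed.

Lemma degree_setD E A v : A \subset E ->
  degree E v = degree A v + degree (E :\: A) v.
Proof. by move=> /setIidPr AE; rewrite !degree_sum (big_setID A) /= AE. Qed.

Lemma degree_setU E B v : [disjoint B & E] ->
  degree (B :|: E) v = degree B v + degree E v.
Proof.
move=> dBE; rewrite !degree_sum -bigU //=.
by apply: eq_bigl => e; rewrite !inE.
Qed.

Lemma degree_pair (a b c d v : T) : a != c -> a != d -> a != b -> c != d ->
  degree [set [set a; b]; [set c; d]] v
  = (v == a) + (v == b) + (v == c) + (v == d).
Proof.
move=> ac ad ab cd; rewrite degree_sum big_setU1 ?inE ?set2_neq //= big_set1 !inE.
case: (eqVneq v a) => [->|_]; first by rewrite (negPf ab) (negPf ac) (negPf ad).
by case: (eqVneq v c) => [->|_]; rewrite ?(negPf cd) ?addn0 ?orbF //=; do 2!case: eqP.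
Qed.

(** The removed and the added pair of edges have the same four endpoints, each used once, so every
    degree is preserved. *)
Lemma switch_realizes V (d : T -> nat) E i j k l : realizes V d E ->
    i != k -> j != l -> [set i; j] \in E -> [set k; l] \in E ->
    [set i; k] \notin E -> [set j; l] \notin E ->
  realizes V d ([set [set i; k]; [set j; l]]
                :|: (E :\: [set [set i; j]; [set k; l]])).
Proof.
move=> /andP[gE dE] ik jl ijE klE ikE jlE.
have ij := edge_neq _ _ _ _ gE ijE; have kl := edge_neq _ _ _ _ gE klE.
(* If [i = l], the edge [kl] would be the non-edge [ik]. *)
have il : i != l by apply: contraNneq ikE => ->; rewrite setUC.
have [_ /subsetP ijV] := is_graphP _ _ _ gE ijE.
have [_ /subsetP klV] := is_graphP _ _ _ gE klE.
have [iV jV] : i \in V /\ j \in V by split; apply: ijV; rewrite !inE eqxx ?orbT.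
have [kV lV] : k \in V /\ l \in V by split; apply: klV; rewrite !inE eqxx ?orbT.
apply/andP; split.
  apply/forall_inP => e; rewrite 2!inE => /orP[|].
    rewrite !inE => /orP[]/eqP->; rewrite cards2 ?ik ?jl /=;
    by apply/subsetP => x; rewrite !inE => /orP[]/eqP->.
  by rewrite inE => /andP[_]; move: e; apply/forall_inP.
apply/forall_inP => v vV; rewrite -(eqP (forall_inP dE v vV)).
rewrite degree_setU; last first.
  apply/pred0P => e /=; rewrite !inE; apply/negP => /andP[+ /andP[_ eE]].
  by case/orP => /eqP ee; move: eE; rewrite ee; apply/negP.
rewrite [degree E v](degree_setD E [set [set i; j]; [set k; l]]); last first.
  by apply/subsetP => e; rewrite !inE => /orP[]/eqP->.
by rewrite !degree_pair // [_ + (v == k) + _]addnAC.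
Qed.

Lemma forced_edge_shift V (d : T -> nat) i j k : k \in V -> d j <= d k -> i != k ->
    (forall E, realizes V d E -> [set i; j] \in E) ->
  forall E, realizes V d E -> [set i; k] \in E.
Proof.
move=> kV djk ik forced E rE; apply: contraT => ikE.
have ijE := forced E rE; have /andP[gE /forall_inP dE] := rE.
have jV : j \in V.
  have [_ /subsetP] := is_graphP _ _ _ gE ijE.
  by apply; rewrite !inE eqxx orbT.
have ij := edge_neq _ _ _ _ gE ijE.
have nbr : #|neighbors E j| <= #|neighbors E k|.
  by rewrite -!(degree_neighbors V) // (eqP (dE j jV)) (eqP (dE k kV)).
have [l] : exists l, [&& [set k; l] \in E, [set j; l] \notin E & j != l].
  apply/existsP; apply: contraT; rewrite negb_exists => /forallP noL.
  (* Removing [j] and [k] from each other's neighborhoods costs both sides the same amount, so this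
     strict inequality contradicts [nbr]. *)
  suff: #|neighbors E k :\ j| < #|neighbors E j :\ k|.
    move: nbr; rewrite (cardsD1 k (neighbors E j)) (cardsD1 j (neighbors E k)).
    by rewrite !inE [[set k; j]]setUC leq_add2l leqNgt => /negPf->.
  apply/proper_card/properP; split.
    apply/subsetP => l; rewrite !inE => /andP[lj klE].
    move: (noL l); rewrite klE [j == l]eq_sym lj andbT negbK => ->.
    by rewrite eq_sym (edge_neq _ _ _ _ gE klE).
  (* The vertex [i] makes the inclusion proper: it is adjacent to [j] but not to [k]. *)
  exists i; first by rewrite !inE ik setUC.
  by rewrite !inE [[set k; i]]setUC (negPf ikE) andbF.
case/and3P => klE jlE jl.
have := forced _ (switch_realizes _ _ _ _ _ _ _ rE ik jl ijE klE ikE jlE).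
have jk : j != k by apply: contraNneq ikE => <-.
(* The switch removed [ij], so [ij] would have to equal one of the new edges [ik], [jl]. *)
rewrite !inE eqxx /= orbF => /orP[]; apply: contraTT => _.
  by rewrite [X in X != _]setUC set2_neq // eq_sym.
by apply: set2_neq => //; apply: contraNneq ikE => ->; rewrite setUC.
Qed.

(** Here [d] is an arbitrary ranking of the vertices; it is applied to the degrees in [alpha], not
    to those in [F]. *)
Lemma nested_threshold V F (d : T -> nat) : is_graph V F ->
    (forall i j k, k \in V -> d j <= d k -> i != k ->
       [set i; j] \in F -> [set i; k] \in F) ->
  threshold V F.
Proof.
move=> gF nested; rewrite /threshold gF; apply/cards1P; exists F.
apply/setP => F'; rewrite !inE; apply/idP/eqP => [/andP[gF' dF']|->]; last first.
  by rewrite /realizes gF; apply/forall_inP.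
(* [D] holds exactly at the vertices covered by the symmetric difference of [F] and [F']. *)
pose D := [pred v | (v \in V) && (neighbors F v != neighbors F' v)].
have inV E v w : is_graph V E -> [set v; w] \in E -> v \in V.
  move=> gE /(is_graphP _ _ _ gE)[_ /subsetP]; apply.
  by rewrite !inE eqxx.
have noD v : ~~ D v -> neighbors F v = neighbors F' v.
  rewrite /= negb_and negbK => /orP[vV|/eqP//]; apply/setP => w; rewrite !inE.
  apply/idP/idP => vw; case/negP: vV; first exact: inV gF vw.
  exact: inV gF' vw.
have cardN v : v \in V -> #|neighbors F v| = #|neighbors F' v|.
  move=> vV; rewrite -!(degree_neighbors V) //.
  by rewrite (eqP (forall_inP dF' v vV)).
case: (pickP D) => [v0 Dv0|D0].
  case: (arg_maxnP d Dv0) => v /andP[vV vD] vmax.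
  (* Neighborhoods of equal size that differ cannot be nested; the same argument at [w] yields
     [x]. *)
  have : ~~ (neighbors F' v \subset neighbors F v).
    by apply: contra vD => sub; rewrite eq_sym eqEcard sub cardN /=.
  case/subsetPn => w; rewrite !inE => vwF' vwF.
  have wV : w \in V by apply: (inV F' w v) => //; rewrite setUC.
  have : ~~ (neighbors F w \subset neighbors F' w).
    apply: contra vwF => sub; have : neighbors F w == neighbors F' w.
      by rewrite eqEcard sub cardN /=.
    by move/eqP/setP/(_ v); rewrite !inE ![[set w; v]]setUC vwF'.
  case/subsetPn => x; rewrite !inE => wxF wxF'.
  have Dx : D x.
    rewrite /= (inV F x w) //=; last by rewrite setUC.
    apply/eqP => /setP/(_ w).
    by rewrite !inE ![[set x; w]]setUC wxF (negPf wxF').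
  (* Since [x] satisfies [D], maximality gives [d x <= d v], so the edge [wx] of [F] shifts to
     [wv]. *)
  case/negP: vwF; rewrite setUC; apply: (nested w x v) => //; first exact: vmax.
  by rewrite eq_sym (edge_neq _ _ _ _ gF' vwF').
have eqN a b : ([set a; b] \in F) = ([set a; b] \in F').
  by have /setP/(_ b) := noD a (negbT (D0 a)); rewrite !inE.
apply/setP => e; apply/idP/idP => eE.
  have [/eqP/cards2P[a [b [_ eab]]] _] := is_graphP _ _ _ gF' eE.
  by rewrite eab eqN -eab.
have [/eqP/cards2P[a [b [_ eab]]] _] := is_graphP _ _ _ gF eE.
by rewrite eab -eqN -eab.
Qed.

End Graphs.

Theorem theorem10 (n : nat) (alpha : n.-tuple nat)
    (alpha_degseq : degree_sequence alpha) (alpha_graphic : graphic alpha) :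
  threshold (forced_vertices alpha) (forced_set alpha).
Proof.
apply: (nested_threshold _ _ _ (tnth alpha)).
  apply/forall_inP => e eF; have := eF; rewrite inE => /andP[e2 _].
  rewrite e2 /=; have /cards2P[a [b [_ eab]]] := e2; move: eF; rewrite eab => abF.
  apply/subsetP => x; rewrite !inE => /orP[]/eqP->; apply/existsP.
    by exists b.
  by exists a; rewrite setUC.
move=> i j k _ djk ik; rewrite !inE !cards2 ik => /andP[_ /forall_inP forced].
(* The exchange takes place in realizations on all of [[set: 'I_n]], not inside the forced graph. *)
apply/forall_inP; apply: (forced_edge_shift _ _ _ _ j k _ djk ik forced).
by rewrite inE.
Qed.
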